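(* Let $\mathbf X$ be a recursive ML model (on some DAG $\mathcal D$ with node set $V=\{1,\dots,d\}$, with noise variables $Z_1,\dots,Z_d$) with ML coefficient matrix $B=(b_{ij})_{d\times d}$. Let $\mathcal D^B=(V,E^B)$ be the minimum ML DAG of $\mathbf X$ and let $\mathrm{pa}^B(i)$ be the parents of node $i$ in $\mathcal D^B$. For a DAG $\mathcal D'$ on $V$ with parent sets $\mathrm{pa}(i)$ and positive weights $c_{ki}$ ($i\in V$, $k\in\mathrm{pa}(i)\cup\{i\}$), say that $\mathcal D'$ represents $\mathbf X$ with these weights if $$X_i=\bigvee_{k\in\mathrm{pa}(i)}c_{ki}X_k\vee c_{ii}Z_i,\qquad i=1,\dots,d. \tag{$*$}$$ (a) The minimum ML DAG $\mathcal D^B$ is the DAG with the minimum number of edges such that $\mathbf X$ satisfies $( * )$. The weights in $( * )$ relative to $\mathcal D^B$ are uniquely given by $c_{ii}=b_{ii}$ and $c_{ki}=\frac{b_{ki}}{b_{kk}}$ for $i\in V$ and $k\in\mathrm{pa}^B(i)$. (b) Every DAG with node set $V$ that has at least the edges of $\mathcal D^B$ and the same reachability matrix as $\mathcal D^B$ represents $\mathbf X$ in the sense of $( * )$ with weights given for all $i\in V$ by $$c_{ii}=b_{ii};\quad c_{ki}=\frac{b_{ki}}{b_{kk}}\ \text{ for } k\in\mathrm{pa}^B(i);\quad\text{and } c_{ki}\in\Big(0,\frac{b_{ki}}{b_{kk}}\Big]\ \text{ for } k\in\mathrm{pa}(i)\setminus\mathrm{pa}^B(i),$$ where $\mathrm{pa}(i)$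 are the parents of $i$ in that DAG. There are no further DAGs and weights such that $\mathbf X$ has representation $( * )$.
   Context: For a DAG $\mathcal D=(V,E)$ with $V=\{1,\dots,d\}$ and $i\in V$, $\mathrm{pa}(i)$, $\mathrm{an}(i)$, $\mathrm{de}(i)$ are the parents, ancestors and descendants of $i$ (ancestors/descendants via directed paths of length at least one). $P_{ji}$ is the set of directed paths from $j$ to $i$. A recursive max-linear (ML) model on $\mathcal D$ is a random vector $\mathbf X=(X_1,\dots,X_d)$ defined recursively by $X_i=\bigvee_{k\in \mathrm{pa}(i)} c_{ki}X_k\vee c_{ii}Z_i$, $i=1,\dots,d$, with independent non-negative random variables $Z_1,\dots,Z_d$ (noise variables), each with support $\mathbb R_+=[0,\infty)$, and positive weights $c_{ki}$, $k\in\mathrm{pa}(i)\cup\{i\}$; equalities of random variables are understood almost surely. The weight of a path $p=[j=k_0\to\dots\to k_n=i]$ is $d_{ji}(p)=c_{k_0,k_0}\prod_{l=0}^{n-1}c_{k_l,k_{l+1}}$. The ML coefficient matrix $B=(b_{ij})_{d\times d}$ of $\mathbf X$ is given, for $i\in V$, by $b_{ji}=\bigvee_{p\in P_{ji}}d_{ji}(p)$ for $j\in\mathrm{an}(i)$, $b_{ii}=c_{ii}$, and $b_{ji}=0$ otherwise; it satisfies $X_i=\bigvee_{j=1}^d b_{ji}Z_j$. The minimum ML DAG of $\mathbf X$ is $$\mathcal D^B=(V,E^B),\qquad E^B=\Big\{(k,i)\in E:\ b_{ki}>\bigvee_{l\in\mathrm{de}(k)\cap\mathrm{pa}(i)}\frac{b_{kl}b_{li}}{b_{ll}}\Big\}.$$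 The reachability matrix of a DAG has $ji$-th entry $1$ if there is a directed path from $j$ to $i$ or $j=i$, and $0$ otherwise. A maximum over the empty set is $0$. *)

(* Defs.v *)
From HB Require Import structures.
From mathcomp Require Import all_boot all_order all_algebra.
From mathcomp Require Import all_classical all_reals all_analysis.

Set Implicit Arguments.
Unset Strict Implicit.
Unset Printing Implicit Defensive.

Import Order.TTheory GRing.Theory Num.Theory.
Import numFieldNormedType.Exports.

Local Open Scope classical_set_scope.
Local Open Scope ring_scope.

(* A directed graph on V = 'I_d is its edge set E; the pair (k, i) is the
   edge k -> i.  Real families indexed by two nodes are written source first:
   c k i is the weight c_ki, and B j i is the coefficient b_ji. *)

Section Graphs.
Variable d : nat.
Implicit Types (E : {set 'I_d * 'I_d}) (i j k : 'I_d).

Definition edge E : rel 'I_d := fun k i => (k, i) \in E.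

Definition pa E i : {set 'I_d} := [set k | edge E k i]%SET.

(* [connect] is reflexive-transitive, so the first step is made explicit to
   get directed paths of length at least one. *)
Definition has_path E j i : bool :=
  [exists k, edge E j k && connect (edge E) k i].

Definition an E i : {set 'I_d} := [set j | has_path E j i]%SET.

Definition de E k : {set 'I_d} := [set l | has_path E k l]%SET.

Definition is_dag E : Prop := forall i, ~~ has_path E i i.

Definition reachability_mx E : 'M[nat]_d :=
  \matrix_(j, i) (connect (edge E) j i : nat).

(* j :: p is a directed path from j to i. *)
Definition is_path_to E j i (p : seq 'I_d) : bool :=
  path (edge E) j p && (last j p == i).

(* The maximum over P_ji in [ml_coef] ranges over the p with size p < d; by
   this lemma these are all the directed paths of a DAG. *)
Lemma dag_path_size E j (p : seq 'I_d) :
  is_dag E -> path (edge E) j p -> (size p < d)%N.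
Proof.
move=> dagE.
have uniq_path : forall q k, path (edge E) k q -> uniq (k :: q).
  elim=> [//|x q IHq] k /= /andP[kx xq].
  have := IHq x xq => /= ->; rewrite andbT; apply/negP => kxq.
  move/negP: (dagE k); apply; apply/existsP; exists x; rewrite kx /=.
  exact: (path_connect xq).
by move=> /uniq_path /card_uniqP /= <-; rewrite -[X in (_ <= X)%N]card_ord max_card.
Qed.

End Graphs.

Section MaxLinear.
Variables (R : realType) (d : nat).
Implicit Types (E : {set 'I_d * 'I_d}) (c : 'I_d -> 'I_d -> R) (B : 'M[R]_d).

(* [pairmap c j p] lists c_(k_l, k_(l+1)) along the path j :: p. *)
Definition path_weight c (j : 'I_d) (p : seq 'I_d) : R :=
  c j j * \prod_(w <- pairmap c j p) w.

Definition ml_coef E c : 'M[R]_d :=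
  \matrix_(j, i)
    if j == i then c i i
    else if j \in an E i then
      \big[Num.max/0]_(n < d)
        \big[Num.max/0]_(p : n.-tuple 'I_d | is_path_to E j i p)
          path_weight c j p
    else 0.

Definition min_ml_dag E B : {set 'I_d * 'I_d} :=
  [set ki in E |
     \big[Num.max/0]_(l in de E ki.1 :&: pa E ki.2)
        (B ki.1 l * B l ki.2 / B l l) < B ki.1 ki.2]%SET.

Definition positive_weights E c : Prop :=
  forall i k, k \in (i |: pa E i)%SET -> 0 < c k i.

End MaxLinear.

Section Probability.
Context (R : realType) (disp : measure_display) (T : measurableType disp).
Variable P : probability T R.

Definition mutually_independent (I : finType) (Z : I -> {RV P >-> R}) : Prop :=
  forall (J : {set I}) (A : I -> set R),
    (forall j, measurable (A j)) ->
    P (\bigcap_(j in [set` J]) (Z j @^-1` A j)) =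
    (\prod_(j in J) P (Z j @^-1` A j))%E.

Definition law_support (Y : {RV P >-> R}) : set R :=
  [set x | forall U : set R, open U -> U x -> (0 < distribution P Y U)%E].

Variable d : nat.
Implicit Types (E : {set 'I_d * 'I_d}) (c : 'I_d -> 'I_d -> R).
Implicit Types X Z : 'I_d -> {RV P >-> R}.

Definition noise Z : Prop :=
  [/\ mutually_independent Z,
      forall i, {ae P, forall w, 0 <= Z i w}
    & forall i, law_support (Z i) = `[0, +oo[%classic].

Definition represents X Z E c : Prop :=
  positive_weights E c /\
  forall i, {ae P, forall w,
    X i w = Num.max (\big[Num.max/0]_(k in pa E i) (c k i * X k w))
                    (c i i * Z i w)}.

Definition recursive_ml_model X Z E c : Prop :=
  [/\ is_dag E, noise Z & represents X Z E c].

End Probability.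

(* Main.v *)
Require Import Defs.
From HB Require Import structures.
From mathcomp Require Import all_boot all_order all_algebra.
From mathcomp Require Import all_classical all_reals all_analysis.

Set Implicit Arguments.
Unset Strict Implicit.
Unset Printing Implicit Defensive.

Import Order.TTheory GRing.Theory Num.Theory.
Import numFieldNormedType.Exports.

Local Open Scope classical_set_scope.
Local Open Scope ring_scope.

(** The theorem reduces to an identity between nonnegative matrices.

    Solving the model equations along the DAG writes each [X i] as the
    max-linear function of the noise with coefficients [B j i]
    ([model_max_linear]).  These coefficients are determined by [X] and [Z]
    ([max_linear_coef_inj]): with positive probability one noise variable is
    larger than [1] while all the others are as small as desired, and then the
    maximum reads off the coefficient of that variable.  Hence substituting
    the max-linear forms into the equations of an arbitrary graph [E'] with
    positive weights [c'] shows that [E'] represents [X] if and only if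

      B j i = max over the parents k of i in E' of c' k i * B j k,
              together with c' i i when j = i

    ([represents_recursion], with the recursion named [ml_recursion]).  From
    there on no probability is involved, and no path weights either: the
    maxima over paths that define [B] enter only through the fact that they
    obey the recursion of the given DAG ([ml_coef_recursion]).

    On a DAG the recursion gives [B j k * B k i <= B j i * B k k]
    ([coef_supermul]), forces [c' i i = B i i], bounds the weight of an edge
    by [B k i / B k k], and makes [B j i] positive exactly when [j] reaches
    [i].  Call [(k, i)] irreducible when [k != i], [0 < B k i] and
    [B k l * B l i < B k i * B l l] for every third node [l].  Irreducible pairs are exactly the edges of the
    minimum DAG ([min_ml_dagP]), yet they are defined by [B] alone.  In any DAG
    obeying the recursion an irreducible pair must be an edge, and its weight
    must be [B k i / B k k], since otherwise the maximum would be attained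
    through a third node ([irreducible_edge]).  Conversely the irreducible
    pairs with these weights already satisfy the recursion, because [B j i]
    factors through the last possible intermediate node
    ([min_ml_dag_factor]); further edges with weights at most [B k i / B k k]
    do not change the maxima ([min_ml_dag_recursion]).  *)

(** * Directed acyclic graphs *)

Section Dag.
Variable d : nat.
Implicit Types (E : {set 'I_d * 'I_d}) (i j k l : 'I_d).

Lemma mem_pa E k i : (k \in pa E i) = edge E k i.
Proof. by rewrite inE. Qed.

Lemma edge_connect_has_path E j k i :
  edge E j k -> connect (edge E) k i -> has_path E j i.
Proof. by move=> jk ki; apply/existsP; exists k; rewrite jk. Qed.

Lemma has_path_connect E j i : has_path E j i -> connect (edge E) j i.
Proof. by move=> /existsP[k /andP[/connect1 jk]]; apply: connect_trans. Qed.

Lemma connect_has_path E j i :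
  j != i -> connect (edge E) j i -> has_path E j i.
Proof.
move=> ji /connectP[[|k p] /=]; first by move=> _ eji; rewrite eji eqxx in ji.
move=> /andP[jk kp] ->; apply: edge_connect_has_path jk _.
by apply/connectP; exists p.
Qed.

Lemma dag_connect_anti E j i :
  is_dag E -> connect (edge E) j i -> connect (edge E) i j -> j = i.
Proof.
move=> dagE ji ij; apply/eqP; apply: contraT => /connect_has_path /(_ ji).
move=> /existsP[k /andP[jk ki]]; have /negP[] := dagE j.
exact: edge_connect_has_path jk (connect_trans ki ij).
Qed.

Lemma dag_edge_neq E k i : is_dag E -> edge E k i -> k != i.
Proof.
move=> dagE ki; apply/eqP => eki; rewrite eki in ki.
by have /negP[] := dagE i; apply: edge_connect_has_path ki (connect0 _ _).
Qed.

Lemma edgeS E E' k i : E \subset E' -> edge E k i -> edge E' k i.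
Proof. by move=> /fintype.subsetP; apply. Qed.

Lemma sub_dag E E' : E \subset E' -> is_dag E' -> is_dag E.
Proof.
move=> sEE dagE i; apply: contra (dagE i) => /existsP[k /andP[ik ki]].
apply: (edge_connect_has_path (edgeS sEE ik)).
by apply: connect_sub ki => x y xy; apply/connect1/(edgeS sEE).
Qed.

(** Counting ancestors gives a height function: the ancestors of the source of
    a path are ancestors of its target, and so is the source itself, which
    acyclicity keeps out of its own ancestors. *)
Lemma card_an_lt E k i :
  is_dag E -> has_path E k i -> (#|an E k| < #|an E i|)%N.
Proof.
move=> dagE ki; apply: proper_card; apply/properP; split.
  apply/fintype.subsetP => j; rewrite !inE => /existsP[l /andP[jl lk]].
  apply: edge_connect_has_path jl (connect_trans lk _).
  exact: has_path_connect.
by exists k; rewrite inE // dagE.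
Qed.

Lemma dag_ind E (Q : 'I_d -> Prop) :
  is_dag E -> (forall i, (forall k, edge E k i -> Q k) -> Q i) ->
  forall i, Q i.
Proof.
move=> dagE IH i; have [n] := ubnP #|an E i|.
elim: n i => // n IHn i; rewrite ltnS => le_n.
apply: IH => k ki; apply: IHn; apply: leq_trans le_n.
by apply: card_an_lt => //; apply: edge_connect_has_path ki (connect0 _ _).
Qed.

End Dag.

(** * Matrices obeying the max-linear recursion *)

Section MaxLinear.
Variables (R : realType) (d : nat).
Implicit Types (E : {set 'I_d * 'I_d}) (c : 'I_d -> 'I_d -> R) (B : 'M[R]_d).
Implicit Types (i j k l : 'I_d) (a x z : 'I_d -> R).

(** The maximum attached to a node by the weights: feeding it the values of
    the model gives the model equation, and feeding it a row of coefficients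
    gives the recursion of [ml_recursion]. *)
Definition ml_step E c x (zi : R) i : R :=
  Num.max (\big[Num.max/0]_(k in pa E i) (c k i * x k)) zi.

Definition ml_recursion E c B : Prop :=
  forall j i, B j i = ml_step E c (B j) (if j == i then c i i else 0) i.

Definition max_linear a z : R := \big[Num.max/0]_j (a j * z j).

Lemma ml_step_leP E c x (zi m : R) i : 0 <= m ->
  reflect ((forall k, edge E k i -> c k i * x k <= m) /\ zi <= m)
          (ml_step E c x zi i <= m).
Proof.
move=> m0; rewrite /ml_step ge_max.
apply: (iffP andP) => [[/bigmax_leP[_ le_m] zm]|[le_m zm]]; split => //.
  by move=> k ki; apply: le_m; rewrite mem_pa.
by apply/bigmax_leP; split => // k; rewrite mem_pa; apply: le_m.
Qed.

Lemma le_ml_step E c x (zi : R) k i :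
  edge E k i -> c k i * x k <= ml_step E c x zi i.
Proof.
move=> ki; rewrite /ml_step le_max; apply/orP; left.
by apply: (le_bigmax_cond _ (fun k => c k i * x k)); rewrite mem_pa.
Qed.

Lemma ml_step_ge_last E c x (zi : R) i : zi <= ml_step E c x zi i.
Proof. by rewrite /ml_step le_max lexx orbT. Qed.

Lemma ml_step_ge0 E c x (zi : R) i : 0 <= ml_step E c x zi i.
Proof. by rewrite /ml_step le_max bigmax_ge_id. Qed.

Lemma ml_step_attained E c x (zi : R) i : 0 < ml_step E c x zi i ->
  ml_step E c x zi i = zi \/
  exists2 k, edge E k i & ml_step E c x zi i = c k i * x k.
Proof.
move=> pos; have := lexx (ml_step E c x zi i).
rewrite {2}/ml_step le_max => /orP[/bigmax_geP[|[k]]|le_zi].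
- by rewrite leNgt pos.
- rewrite mem_pa => ki le_k; right; exists k => //.
  by apply/le_anti; rewrite le_k le_ml_step.
by left; apply/le_anti; rewrite le_zi ml_step_ge_last.
Qed.

Section Recursion.
Variables (E : {set 'I_d * 'I_d}) (c : 'I_d -> 'I_d -> R) (B : 'M[R]_d).
Hypotheses (dagE : is_dag E) (posc : positive_weights E c).
Hypothesis recB : ml_recursion E c B.

Let edge_pos k i : edge E k i -> 0 < c k i.
Proof. by move=> ki; apply: posc; rewrite !inE ki orbT. Qed.

Let self_pos i : 0 < c i i.
Proof. by apply: posc; rewrite !inE eqxx. Qed.

Lemma coef_ge0 j i : 0 <= B j i.
Proof. by rewrite recB ml_step_ge0. Qed.

Lemma coef_edge_le j k i : edge E k i -> c k i * B j k <= B j i.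
Proof. by move=> ki; rewrite [leRHS]recB le_ml_step. Qed.

Lemma coef_attained j i : j != i -> 0 < B j i ->
  exists k, [/\ edge E k i, 0 < B j k & B j i = c k i * B j k].
Proof.
move=> ji Bji; have := Bji; rewrite recB (negPf ji) => pos.
have [e0|[k ki eB]] := ml_step_attained pos; first by rewrite e0 ltxx in pos.
exists k; split=> //.
by move: pos; rewrite eB pmulr_rgt0 // edge_pos.
Qed.

Lemma coef_gt0 j i : (0 < B j i) = connect (edge E) j i.
Proof.
apply/idP/idP; last first.
  move=> /connectP[p]; elim/last_ind: p i => [i _ ->|p i IHp l] /=.
    by rewrite recB eqxx; apply: lt_le_trans (ml_step_ge_last _ _ _ _ _).
  rewrite rcons_path last_rcons => /andP[jp ki] ->.
  apply: lt_le_trans (coef_edge_le j ki).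
  by rewrite mulr_gt0 ?edge_pos // IHp.
move: i; apply: (dag_ind dagE) => i IHi Bji.
have [-> //|ji] := eqVneq j i.
have [k [ki Bjk _]] := coef_attained ji Bji.
exact: connect_trans (IHi k ki Bjk) (connect1 ki).
Qed.

Lemma coef_diag_gt0 i : 0 < B i i.
Proof. by rewrite coef_gt0. Qed.

Lemma coef_gt0_trans j k i : 0 < B j k -> 0 < B k i -> 0 < B j i.
Proof. by rewrite !coef_gt0; apply: connect_trans. Qed.

Lemma coef_gt0_anti j i : 0 < B j i -> 0 < B i j -> j = i.
Proof. by rewrite !coef_gt0; apply: dag_connect_anti. Qed.

(** A parent of [i] is not reached from [i], so that the maximum over the
    parents vanishes and leaves the noise weight. *)
Lemma coef_diag i : c i i = B i i.
Proof.
rewrite recB eqxx; apply/le_anti; rewrite ml_step_ge_last /=.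
apply/ml_step_leP; first exact: ltW.
split=> // k ki; have: ~~ (0 < B i k).
  rewrite coef_gt0; apply/negP => /(edge_connect_has_path ki) kk.
  by have /negP[] := dagE k.
rewrite -leNgt => Bik; apply: le_trans (ltW (self_pos i)).
by rewrite pmulr_rle0 ?edge_pos.
Qed.

Lemma edge_weight_le k i : edge E k i -> c k i <= B k i / B k k.
Proof.
by move=> ki; rewrite ler_pdivlMr ?coef_diag_gt0 // coef_edge_le.
Qed.

(** Concatenating a path into [k] with a path out of [k] counts the noise
    weight of [k] twice, which is what [B k k] compensates. *)
Lemma coef_supermul j k i : B j k * B k i <= B j i * B k k.
Proof.
move: i; apply: (dag_ind dagE) => i IHi.
have [<- //|ki] := eqVneq k i.
have [Bki|] := boolP (0 < B k i); last first.
  rewrite -leNgt => Bki; have -> : B k i = 0.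
    by apply/le_anti; rewrite Bki coef_ge0.
  by rewrite mulr0 mulr_ge0 ?coef_ge0.
have [l [li Bkl ->]] := coef_attained ki Bki.
rewrite mulrCA; apply: (@le_trans _ _ (c l i * (B j l * B k k))).
  by rewrite ler_pM2l ?edge_pos ?IHi.
by rewrite mulrA ler_wpM2r ?coef_ge0 ?coef_edge_le.
Qed.

End Recursion.

(** * The minimum DAG in terms of its coefficients *)

(** These pairs depend on the coefficients only, not on a DAG; they are the
    pairs whose coefficient is not a product through an intermediate node. *)
Definition irreducible_pair B k i : Prop :=
  [/\ k != i, 0 < B k i
    & forall l, l != k -> l != i -> B k l * B l i < B k i * B l l].

Section Irreducible.
Variables (E : {set 'I_d * 'I_d}) (c : 'I_d -> 'I_d -> R) (B : 'M[R]_d).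
Hypotheses (dagE : is_dag E) (posc : positive_weights E c).
Hypothesis recB : ml_recursion E c B.

Let Bii := coef_diag_gt0 dagE posc recB.
Let B0 := coef_ge0 recB.
Let cpos k i (ki : edge E k i) : 0 < c k i.
Proof. by apply: posc; rewrite !inE ki orbT. Qed.

(** The coefficient of the pair is attained at some edge into [i]; if this
    edge did not start at [k], its source would be a forbidden intermediate
    node. *)
Lemma irreducible_edge k i : irreducible_pair B k i ->
  edge E k i /\ c k i = B k i / B k k.
Proof.
move=> [ki Bki irr].
have [l [li Bkl eB]] := coef_attained posc recB ki Bki.
have [elk|lk] := eqVneq l k.
  subst l; split=> //; rewrite eB mulfK //.
  by rewrite gt_eqF.
have := irr l lk (dag_edge_neq dagE li).
rewrite ltNge => /negP[]; rewrite eB mulrAC [leRHS]mulrC.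
by apply: ler_wpM2r; rewrite ?B0 // (coef_edge_le recB).
Qed.

Lemma min_ml_dagP k i :
  (k, i) \in min_ml_dag E B <-> irreducible_pair B k i.
Proof.
rewrite inE /=; split; last first.
  move=> irr; have [ki _] := irreducible_edge irr; apply/andP; split => //.
  have [_ Bki {}irr] := irr.
  apply/bigmax_ltP; split=> // l; rewrite !inE => /andP[kl li].
  rewrite ltr_pdivrMr //; apply: irr; last exact: dag_edge_neq li.
  by apply/eqP => elk; have /negP[] := dagE k; rewrite -{2}elk.
move=> /andP[ki /bigmax_ltP[Bki irr]]; split=> //.
  exact: dag_edge_neq ki.
move=> l lk li.
have [Bkl|] := boolP (0 < B k l); last first.
  rewrite -leNgt => Bkl; apply: le_lt_trans (mulr_gt0 Bki (Bii l)).
  by rewrite mulr_le0_ge0 ?B0.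
have [Bli|] := boolP (0 < B l i); last first.
  rewrite -leNgt => Bli; apply: le_lt_trans (mulr_gt0 Bki (Bii l)).
  by rewrite mulr_ge0_le0 ?B0.
(* The definition of the minimum DAG only compares with parents of [i],
   whereas [l] is arbitrary: the last edge [m -> i] of a path of maximal
   weight from [l] to [i] provides such a parent. *)
have [m [mi Blm eB]] := coef_attained posc recB li Bli.
have Bkm := coef_gt0_trans dagE posc recB Bkl Blm.
have km : k != m.
  apply/eqP => ekm; move/eqP: lk; apply; rewrite -ekm in Blm.
  exact: (coef_gt0_anti dagE posc recB).
have Bmm := Bii m; have cmi := cpos mi.
have irr_m : B k m * B m i / B m m < B k i.
  apply: irr; rewrite !inE; apply/andP; split => //.
  by apply: connect_has_path => //; rewrite -(coef_gt0 dagE posc recB).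
have lt_m : c m i * B k m < B k i.
  apply: le_lt_trans irr_m; rewrite ler_pdivlMr // mulrAC mulrC.
  by apply: ler_wpM2l; rewrite ?B0 // (coef_edge_le recB).
apply: (@le_lt_trans _ _ (c m i * B k m * B l l)).
  rewrite eB mulrCA -mulrA ler_pM2l //.
  exact: (coef_supermul dagE posc recB).
by rewrite ltr_pM2r.
Qed.

End Irreducible.

(** Among the nodes other than [i] through which [B j i] factors, such as [j]
    itself, one that comes last in the order of the DAG forms an irreducible
    pair with [i]. *)
Lemma min_ml_dag_factor E c B j i : is_dag E -> positive_weights E c ->
  ml_recursion E c B -> j != i -> 0 < B j i ->
  exists2 k, (k, i) \in min_ml_dag E B & B j i = B k i / B k k * B j k.
Proof.
move=> dagE posc recB ji Bji.
have Bii := coef_diag_gt0 dagE posc recB.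
have B0 := coef_ge0 recB.
have superB := coef_supermul dagE posc recB.
pose factor k := [&& k != i, 0 < B j k, 0 < B k i
  & B j i * B k k == B j k * B k i].
have factor_j : factor j by rewrite /factor ji Bii Bji mulrC /=.
have [k /and4P[ki Bjk Bki /eqP eBk] k_max] :=
  @arg_maxnP _ j factor (fun k => #|an E k|) factor_j.
exists k; last first.
  apply: (mulIf (lt0r_neq0 (Bii k))).
  by rewrite eBk mulrAC divfK ?gt_eqF // mulrC.
apply/(min_ml_dagP dagE posc recB); split=> // l lk li.
rewrite ltNge; apply/negP => le_l.
have BkBl : 0 < B k l * B l i by apply: lt_le_trans le_l; rewrite mulr_gt0.
have Bkl : 0 < B k l.
  by rewrite lt_neqAle B0 andbT; apply/eqP => e; rewrite -e mul0r ltxx in BkBl.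
have Bli : 0 < B l i.
  by rewrite lt_neqAle B0 andbT; apply/eqP => e; rewrite -e mulr0 ltxx in BkBl.
(* Otherwise [B j i] factors through [l] too, and [l] comes after [k]. *)
have factor_l : factor l.
  rewrite /factor li Bli (coef_gt0_trans dagE posc recB Bjk Bkl) /=.
  apply/eqP/le_anti; rewrite superB andbT.
  rewrite -(ler_pM2r (Bii k)) mulrAC eBk -mulrA.
  apply: (@le_trans _ _ (B j k * (B k l * B l i))).
    by rewrite ler_pM2l.
  by rewrite mulrA [leRHS]mulrAC ler_pM2r // superB.
have := k_max l factor_l; apply/negP; rewrite -ltnNge.
apply: card_an_lt => //; apply: connect_has_path; first by rewrite eq_sym.
by rewrite -(coef_gt0 dagE posc recB).
Qed.

(** The supermultiplicativity makes every edge with a weight in the given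
    range harmless, so that the edges of the minimum DAG alone decide. *)
Lemma min_ml_dag_recursion E c B E' c' : is_dag E -> positive_weights E c ->
  ml_recursion E c B -> min_ml_dag E B \subset E' ->
  (forall i, c' i i = B i i) ->
  (forall i k, k \in pa (min_ml_dag E B) i -> c' k i = B k i / B k k) ->
  (forall i k, edge E' k i -> c' k i <= B k i / B k k) ->
  ml_recursion E' c' B.
Proof.
move=> dagE posc recB sEE cii ckiB cki j i.
have Bii := coef_diag_gt0 dagE posc recB.
have B0 := coef_ge0 recB.
apply/le_anti/andP; split; last first.
  apply/ml_step_leP => //; split; last by case: eqP => [->|//]; rewrite cii.
  move=> k ki; apply: (@le_trans _ _ (B k i / B k k * B j k)).
    by rewrite ler_wpM2r // cki.
  by rewrite mulrAC ler_pdivrMr // mulrC (coef_supermul dagE posc recB).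
have [<-|ji] := eqVneq j i; first by rewrite -cii ml_step_ge_last.
have [Bji|] := boolP (0 < B j i); last first.
  by rewrite -leNgt => /le_trans; apply; apply: ml_step_ge0.
have [k ki ->] := min_ml_dag_factor dagE posc recB ji Bji.
rewrite -ckiB ?mem_pa //; apply: le_ml_step.
exact: edgeS ki.
Qed.

(** * Maxima over paths obey the recursion *)

Lemma path_weight_rcons c j p i :
  path_weight c j (rcons p i) = path_weight c j p * c (last j p) i.
Proof.
rewrite /path_weight -mulrA; congr (_ * _).
elim: p j => [|k p IHp] j /=; rewrite !big_cons ?IHp ?mulrA //.
by rewrite big_nil mulr1 mul1r.
Qed.

(** For [j = i] the only path of a DAG is the empty one, so the value [c i i]
    that the coefficient has by convention is also its maximum over paths. *)
Lemma path_weight_le E c j i p : is_dag E ->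
  is_path_to E j i p -> path_weight c j p <= ml_coef E c j i.
Proof.
move=> dagE jip; have /andP[jp /eqP lp] := jip; rewrite mxE.
have [eji|ji] := eqVneq j i.
  move: jp lp {jip}; rewrite -eji; case: p => [|k p /= /andP[jk kp] lp].
    by rewrite /path_weight big_nil mulr1.
  have /negP[] := dagE j; apply: edge_connect_has_path jk _.
  by apply/connectP; exists p.
rewrite inE connect_has_path //; last by apply/connectP; exists p.
apply: le_trans (le_bigmax _ _ (Ordinal (dag_path_size dagE jp))) => /=.
exact: (@le_bigmax_cond _ R _ 0 (in_tuple p) (fun q => is_path_to E j i q)
  (fun q : (size p).-tuple _ => path_weight c j q)).
Qed.

Lemma ml_coef_path E c j i : is_dag E -> 0 < ml_coef E c j i ->
  exists2 p, is_path_to E j i p & ml_coef E c j i = path_weight c j p.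
Proof.
move=> dagE Bji; have [eji|ji] := eqVneq j i.
  exists [::]; first by rewrite /is_path_to /= eji.
  by rewrite mxE eji eqxx /path_weight big_nil mulr1.
have: ml_coef E c j i <= ml_coef E c j i by [].
rewrite {2}mxE (negPf ji); case: ifP => _; last by rewrite leNgt Bji.
move=> /bigmax_geP[|[n _ /bigmax_geP[|[p jip le_p]]]]; rewrite ?leNgt ?Bji //.
exists (tval p) => //; apply/le_anti.
by rewrite (path_weight_le _ dagE jip) andbT.
Qed.

(** Split a path at its last edge: the part before it is a path to a parent. *)
Lemma ml_coef_recursion E c :
  is_dag E -> positive_weights E c -> ml_recursion E c (ml_coef E c).
Proof.
move=> dagE posc j i; apply/le_anti/andP; split; last first.
  have B0 j' i' : 0 <= ml_coef E c j' i'.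
    rewrite mxE; case: eqP => [_|_]; last by case: ifP; rewrite ?bigmax_ge_id.
    by apply/ltW/posc; rewrite !inE eqxx.
  apply/ml_step_leP => //; split; last first.
    by case: eqP => // ->; rewrite mxE eqxx.
  move=> k ki; have ck : 0 < c k i by apply: posc; rewrite !inE ki orbT.
  have [Bjk|] := boolP (0 < ml_coef E c j k); last first.
    rewrite -leNgt => Bjk; apply: le_trans (B0 j i).
    by rewrite pmulr_rle0.
  have [p /andP[jp /eqP lp] ->] := ml_coef_path dagE Bjk.
  rewrite mulrC -{1}lp -path_weight_rcons; apply: path_weight_le => //.
  by rewrite /is_path_to rcons_path last_rcons jp lp ki eqxx.
have [Bji|] := boolP (0 < ml_coef E c j i); last first.
  by rewrite -leNgt => /le_trans; apply; apply: ml_step_ge0.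
have [p] := ml_coef_path dagE Bji.
elim/last_ind: p => [|p l _] /andP[jp /eqP lp] ->.
  rewrite /path_weight big_nil mulr1 -lp eqxx; exact: ml_step_ge_last.
move: jp lp; rewrite rcons_path last_rcons => /andP[jp pl] li; subst l.
rewrite path_weight_rcons.
have cp : 0 < c (last j p) i by apply: posc; rewrite !inE pl orbT.
apply: le_trans (le_ml_step _ _ _ pl); rewrite mulrC ler_pM2l //.
by apply: path_weight_le => //; rewrite /is_path_to jp eqxx.
Qed.

(** * Max-linear functions of the noise *)

(** Both sides are the maximum of the same products: multiplication by a
    nonnegative number commutes with maxima, and maxima commute. *)
Lemma ml_step_max_linear E c B z i :
  (forall j, 0 <= z j) -> positive_weights E c ->
  ml_step E c (fun k => max_linear (B^~ k) z) (c i i * z i) i =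
  max_linear (fun j => ml_step E c (B j) (if j == i then c i i else 0) i) z.
Proof.
move=> z0 posc.
have ck k : edge E k i -> 0 < c k i.
  by move=> ki; apply: posc; rewrite !inE ki orbT.
apply/le_anti/andP; split.
  apply/ml_step_leP; first exact: bigmax_ge_id.
  split; last first.
    apply: le_trans (le_bigmax _ _ i).
    by apply: ler_wpM2r => //; rewrite eqxx ml_step_ge_last.
  move=> k ki; rewrite mulrC -ler_pdivlMr ?ck //.
  apply/bigmax_leP; split=> [|j _].
    by rewrite divr_ge0 ?bigmax_ge_id // ltW ?ck.
  rewrite ler_pdivlMr ?ck // mulrC mulrA.
  apply: le_trans (le_bigmax _ _ j).
  by apply: ler_wpM2r => //; apply: le_ml_step.
apply/bigmax_leP; split=> [|j _]; first exact: ml_step_ge0.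
set Bji := ml_step _ _ _ _ _.
have [pos|] := boolP (0 < Bji); last first.
  rewrite -leNgt => le0; apply: le_trans (ml_step_ge0 _ _ _ _ _).
  by rewrite mulr_le0_ge0.
have := ml_step_attained pos; rewrite -/Bji => -[->|[k ki ->]].
  case: eqP => [->|_]; first exact: ml_step_ge_last.
  by rewrite mul0r ml_step_ge0.
apply: le_trans (le_ml_step _ _ _ ki); rewrite -mulrA ler_pM2l ?ck //.
exact: le_bigmax.
Qed.

Lemma eq_ml_step E c x x' (zi : R) i :
  (forall k, edge E k i -> x k = x' k) ->
  ml_step E c x zi i = ml_step E c x' zi i.
Proof.
move=> exx; rewrite /ml_step; congr (Num.max _ _); apply: eq_bigr => k.
by rewrite mem_pa => /exx ->.
Qed.

Lemma ml_recursion_solution E c B x z : is_dag E -> positive_weights E c ->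
  ml_recursion E c B -> (forall j, 0 <= z j) ->
  (forall i, x i = ml_step E c x (c i i * z i) i) ->
  forall i, x i = max_linear (B^~ i) z.
Proof.
move=> dagE posc recB z0 eqx; apply: (dag_ind dagE) => i IHi.
rewrite eqx (eq_ml_step _ _ IHi) ml_step_max_linear //.
by congr max_linear; apply/funext => j; rewrite -recB.
Qed.

End MaxLinear.

(** * Identifying the coefficients from the law of the noise *)

Section Probability.
Context (R : realType) (disp : measure_display) (T : measurableType disp).
Variables (P : probability T R) (d : nat).
Implicit Types (X Z : 'I_d -> {RV P >-> R}) (a b : 'I_d -> R).

(** If [b j0 < a j0], the event that [Z j0] exceeds [1] and that the other
    noise variables are tiny separates the two max-linear functions; by
    independence its probability is a product of positive numbers. *)
Lemma max_linear_coef_le Z a b : noise Z ->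
  (forall j, 0 <= b j) ->
  {ae P, forall w, max_linear a (Z^~ w) = max_linear b (Z^~ w)} ->
  forall j, a j <= b j.
Proof.
move=> [indZ _ suppZ] b0 eq_ab j0; rewrite leNgt; apply/negP => lt_ba.
have a0 : 0 < a j0 by apply: le_lt_trans (b0 j0) lt_ba.
(* Below [a j0 / S] the other variables contribute less than [a j0] to the
   maximum with coefficients [b], whatever the size of these coefficients. *)
pose S := 1 + \sum_j b j.
have S0 : 0 < S by rewrite ltr_wpDr // sumr_ge0.
have bS j : b j < S.
  rewrite /S (bigD1 j) //= addrCA ltrDl ltr_wpDr // sumr_ge0 //.
pose A j : set R := if j == j0 then [set x | 1 < x] else [set x | x < a j0 / S].
have openA j : open (A j).
  by rewrite /A; case: eqP => _; [exact: open_gt|exact: open_lt].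
have measA j : measurable (A j) by apply: measurable_realfun.open_measurable.
pose D := \bigcap_(j in [set` [set: 'I_d]%SET]) (Z j @^-1` A j).
have measD : measurable D.
  apply: fin_bigcap_measurable => // j _.
  by rewrite -[X in measurable X]setTI; apply: measurable_funP.
have PA j : (0 < P (Z j @^-1` A j))%E.
  (* The support points [2] and [0] lie in the open sets of the event. *)
  have : law_support (Z j) (if j == j0 then 2 else 0).
    by rewrite suppZ /= in_itv /= andbT; case: ifP.
  apply => //; rewrite /A; case: eqP => _ /=; first by rewrite ltr1n.
  by rewrite divr_gt0.
have : (0 < P D)%E.
  rewrite /D indZ //; apply: (big_ind (fun x => (0 < x)%E)) => //.
  exact: mule_gt0.
rewrite measure_negligible ?ltxx //.
apply: negligibleS eq_ab => w /= Dw eq_w.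
have ZA j : A j (Z j w) by apply: Dw; rewrite /= inE.
have Zj0 : 1 < Z j0 w by have := ZA j0; rewrite /A eqxx.
have: a j0 * Z j0 w <= max_linear b (Z^~ w).
  by rewrite -eq_w; apply: (le_bigmax _ (fun j => a j * Z j w)).
apply/negP; rewrite -ltNge; apply/bigmax_ltP; split=> [|j _].
  by rewrite mulr_gt0 // (lt_trans _ Zj0).
have [->|jj0] := eqVneq j j0; first by rewrite ltr_pM2r // (lt_trans _ Zj0).
have Zj : Z j w < a j0 / S by have := ZA j; rewrite /A (negPf jj0).
apply: (@le_lt_trans _ _ (b j * (a j0 / S))).
  by rewrite ler_wpM2l // ltW.
apply: (@lt_trans _ _ (a j0)); last by rewrite ltr_pMr.
by rewrite mulrCA gtr_pMr // ltr_pdivrMr // mul1r.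
Qed.

Lemma max_linear_coef_inj Z a b : noise Z ->
  (forall j, 0 <= a j) -> (forall j, 0 <= b j) ->
  {ae P, forall w, max_linear a (Z^~ w) = max_linear b (Z^~ w)} -> a =1 b.
Proof.
move=> noiseZ a0 b0 eq_ab j; apply/le_anti/andP; split.
  exact: (max_linear_coef_le noiseZ b0 eq_ab).
apply: (max_linear_coef_le noiseZ a0).
by apply: filterS eq_ab => w ->.
Qed.

Lemma ae_forall (I : finType) (Q : I -> T -> Prop) :
  (forall i, {ae P, forall w, Q i w}) -> {ae P, forall w, forall i, Q i w}.
Proof. exact: filter_forall. Qed.

Lemma model_max_linear X Z E c : recursive_ml_model X Z E c ->
  forall i, {ae P, forall w, X i w = max_linear ((ml_coef E c)^~ i) (Z^~ w)}.
Proof.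
move=> [dagE [_ /ae_forall Z0 _] [posc /ae_forall eqX]] i.
apply: filterS2 Z0 eqX => w Zw Xw.
exact: (@ml_recursion_solution _ _ _ _ _ (X^~ w) (Z^~ w) dagE posc
  (ml_coef_recursion dagE posc)).
Qed.

(** The graph [E] is arbitrary: substituting the max-linear forms of the
    parents of [i] into the model equation gives a max-linear form of [X i],
    whose coefficients must be those already known. *)
Lemma represents_recursion X Z (B : 'M[R]_d) : noise Z ->
  (forall j i, 0 <= B j i) ->
  (forall i, {ae P, forall w, X i w = max_linear (B^~ i) (Z^~ w)}) ->
  forall E c,
  represents X Z E c <-> positive_weights E c /\ ml_recursion E c B.
Proof.
move=> noiseZ B0 eqX E c; have [_ /ae_forall Z0 _] := noiseZ.
have eq_step i : positive_weights E c ->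
    {ae P, forall w, ml_step E c (X^~ w) (c i i * Z i w) i =
      max_linear (fun j => ml_step E c (B j) (if j == i then c i i else 0) i)
        (Z^~ w)}.
  move=> posc; apply: filterS2 Z0 (ae_forall eqX) => w Zw Xw.
  by rewrite -ml_step_max_linear //; apply: eq_ml_step => k _; apply: Xw.
split=> [[posc repX]|[posc recB]]; split=> //.
  move=> j i; move: j; apply: (max_linear_coef_inj noiseZ) => [//|j|].
    exact: ml_step_ge0.
  by apply: filterS3 (eqX i) (repX i) (eq_step i posc) => w <- -> <-.
move=> i; apply: filterS2 (eqX i) (eq_step i posc) => w -> eq_w.
rewrite -/(ml_step E c (X^~ w) (c i i * Z i w) i) eq_w.
by congr max_linear; apply/funext => j; rewrite -recB.
Qed.

End Probability.

(** * All representations of the model *)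

Theorem theorem5p4 (R : realType) (disp : measure_display)
    (T : measurableType disp) (P : probability T R) (d : nat)
    (X Z : 'I_d -> {RV P >-> R})
    (E : {set 'I_d * 'I_d}) (c : 'I_d -> 'I_d -> R)
    (hX : recursive_ml_model X Z E c) :
  let B := ml_coef E c in
  let EB := min_ml_dag E B in
  (* (a) *)
  ([/\ is_dag EB,
       exists c', represents X Z EB c',
       forall (E' : {set 'I_d * 'I_d}) (c' : 'I_d -> 'I_d -> R),
         is_dag E' -> represents X Z E' c' -> E' <> EB -> (#|EB| < #|E'|)%N
     & forall c' : 'I_d -> 'I_d -> R,
         represents X Z EB c' <->
         (forall i, c' i i = B i i) /\
         (forall i k, k \in pa EB i -> c' k i = B k i / B k k)])
  /\
  (* (b) *)
  (forall (E' : {set 'I_d * 'I_d}) (c' : 'I_d -> 'I_d -> R),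
     is_dag E' ->
     (represents X Z E' c' <->
      [/\ EB \subset E',
          reachability_mx E' = reachability_mx EB,
          forall i, c' i i = B i i,
          forall i k, k \in pa EB i -> c' k i = B k i / B k k
        & forall i k, k \in (pa E' i :\: pa EB i)%SET ->
            0 < c' k i <= B k i / B k k])).
Proof.
move=> B EB; have [dagE noiseZ [posc _]] := hX.
have recB := ml_coef_recursion dagE posc.
have dagEB : is_dag EB.
  apply: sub_dag dagE; apply/fintype.subsetP => -[k i].
  by rewrite inE => /andP[].
have B0 := coef_ge0 recB.
have Bii := coef_diag_gt0 dagE posc recB.
have repP := represents_recursion noiseZ B0 (model_max_linear hX).
have EBP (k i : 'I_d) : (k, i) \in EB <-> irreducible_pair B k i :=
  min_ml_dagP dagE posc recB k i.
have represents_of (E' : {set 'I_d * 'I_d}) (c' : 'I_d -> 'I_d -> R) :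
    EB \subset E' -> (forall i, c' i i = B i i) ->
    (forall i k, k \in pa EB i -> c' k i = B k i / B k k) ->
    (forall i k, k \in (pa E' i :\: pa EB i)%SET ->
       0 < c' k i <= B k i / B k k) ->
    represents X Z E' c'.
  move=> sEE cii ckEB ck.
  have cE' i k : edge E' k i -> 0 < c' k i <= B k i / B k k.
    move=> ki; have [kEB|kEB] := boolP (k \in pa EB i); last first.
      by apply: ck; rewrite finset.in_setD kEB mem_pa.
    rewrite ckEB // lexx andbT divr_gt0 //.
    by have [_] := (EBP k i).1 (etrans (esym (mem_pa EB k i)) kEB).
  apply/repP; split.
    move=> i k; rewrite finset.in_setU1 mem_pa => /predU1P[->|/cE' /andP[]//].
    by rewrite cii.
  by apply: (min_ml_dag_recursion dagE posc recB) => // i k /cE' /andP[].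
have partb (E' : {set 'I_d * 'I_d}) (c' : 'I_d -> 'I_d -> R) : is_dag E' ->
    (represents X Z E' c' <->
      [/\ EB \subset E',
          reachability_mx E' = reachability_mx EB,
          forall i, c' i i = B i i,
          forall i k, k \in pa EB i -> c' k i = B k i / B k k
        & forall i k, k \in (pa E' i :\: pa EB i)%SET ->
            0 < c' k i <= B k i / B k k]).
  move=> dagE'; split; last by case=> *; apply: represents_of.
  move=> /repP[posc' recB'].
  have irr_edge k i := @irreducible_edge _ _ _ _ _ dagE' posc' recB' k i.
  (* The minimum DAG also obeys the recursion, so that both DAGs have the
     reachability given by the positive entries of [B]. *)
  pose cB (k i : 'I_d) := if k == i then B i i else B k i / B k k.
  have [posB recEB] : positive_weights EB cB /\ ml_recursion EB cB B.
    apply/repP; apply: represents_of => // i.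
    - by rewrite /cB eqxx.
    - by move=> k; rewrite mem_pa /cB => /(dag_edge_neq dagEB) /negPf ->.
    - by move=> k; rewrite finset.setDv inE.
  split=> //.
  - by apply/fintype.subsetP => -[k i] /EBP /irr_edge[].
  - apply/matrixP => j i; rewrite !mxE; congr (nat_of_bool _).
    by rewrite -(coef_gt0 dagE' posc' recB') (coef_gt0 dagEB posB recEB).
  - by move=> i; apply: coef_diag recB' i.
  - by move=> i k; rewrite mem_pa => /EBP /irr_edge[].
  - move=> i k; rewrite finset.in_setD !mem_pa => /andP[_ ki].
    rewrite (edge_weight_le dagE' posc' recB' ki) andbT.
    by apply: posc'; rewrite finset.in_setU1 mem_pa ki orbT.
split=> //.
have EBE (c' : 'I_d -> 'I_d -> R) : represents X Z EB c' <->
    (forall i, c' i i = B i i) /\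
    (forall i k, k \in pa EB i -> c' k i = B k i / B k k).
  rewrite partb //; split=> [[]//|[cii ckEB]]; split=> // i k.
  by rewrite finset.setDv inE.
split=> //.
- exists (fun k i => if k == i then B i i else B k i / B k k); apply/EBE.
  split=> [i|i k]; first by rewrite eqxx.
  by rewrite mem_pa => /(dag_edge_neq dagEB) /negPf ->.
- move=> E' c' dagE' /(partb _ _ dagE')[sEE _ _ _ _] neE.
  apply: proper_card; rewrite finset.properEneq sEE andbT; apply/eqP => eE.
  by case: neE.
Qed.
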